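(* Let $q$ be a non-zero complex number such that $q^{6k}\neq 1$ for all non-zero integers $k$, $q\notin P_m\cup R_m$ for every non-zero even integer $m$, and $q\notin S_n$ for every non-zero integer $n$. Let $r\geq 3$ be an odd integer, let $A_1,\dots,A_r\in\{\alpha_1,\alpha_2,\alpha_1\alpha_2,\alpha_2\alpha_1,\alpha_1\alpha_2\alpha_1\}$ be such that $\sum_{i=1}^r\mathrm{length}(A_i)$ is even, and let $x\in C_3$ be $$x=A_1TA_2T\cdots A_{r-1}TA_rT^{1-r}\quad\text{or}\quad x=T^{1-r}A_1TA_2T\cdots A_{r-1}TA_r.$$ Suppose one of the following holds: (a) $A_rA_1=A_2=A_3=\cdots=A_{r-1}$. (b) $A_rA_1=A_{r-1}A_2=\cdots=A_{\frac{r+3}{2}}A_{\frac{r-1}{2}}=1$. (c) There exists $i\in\{0,1,2,\ldots,\frac{r-5}{2}\}$ such that $A_rA_1=A_{r-1}A_2=\cdots=A_{r-i}A_{i+1}=1$ and $A_{r-i-1}A_{i+2}=A_{i+3}=A_{i+4}=\cdots=A_{r-i-2}$. Then $x\notin\ker\rho$.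
   Context: $C_3$ is the group of conjugating automorphisms of the free group $\mathbb{F}_3=\langle x_1,x_2,x_3\rangle$, i.e. the subgroup of $\mathrm{Aut}(\mathbb{F}_3)$ of those $\phi$ with $\phi(x_i)=f_i^{-1}x_{\Pi(i)}f_i$ for a permutation $\Pi$ of $\{1,2,3\}$ and some $f_i\in\mathbb{F}_3$. It is presented by generators $\sigma_1,\sigma_2,\alpha_1,\alpha_2$ and relations $\sigma_1\sigma_2\sigma_1=\sigma_2\sigma_1\sigma_2$, $\alpha_1^2=\alpha_2^2=1$, $\alpha_1\alpha_2\alpha_1=\alpha_2\alpha_1\alpha_2$, $\sigma_1\alpha_2\alpha_1=\alpha_2\alpha_1\sigma_2$, $\sigma_2\sigma_1\alpha_2=\alpha_1\sigma_2\sigma_1$. For a fixed non-zero complex number $q$, the representation $\rho:C_3\to GL_3(\mathbb{C})$ is the homomorphism given by $$\rho(\sigma_1)=\begin{pmatrix} q^2&0&0\\ q(q-1)&1-q&q\\ 0&1&0\end{pmatrix},\quad \rho(\sigma_2)=\begin{pmatrix}1-q&q&q(q-1)\\1&0&0\\0&0&q^2\end{pmatrix},$$ $$\rho(\alpha_1)=\begin{pmatrix}1&0&0\\0&0&1\\0&1&0\end{pmatrix},\quad \rho(\alpha_2)=\begin{pmatrix}0&1&0\\1&0&0\\0&0&1\end{pmatrix}.$$ $T=\sigma_2\alpha_2\alpha_1\in C_3$. The length of a word is the sum of the absolute values of the exponents of the generators in it; thus $\alpha_1,\alpha_2$ have length $1$, $\alpha_1\alpha_2,\alpha_2\alpha_1$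 have length $2$, and $\alpha_1\alpha_2\alpha_1$ has length $3$. All equalities between products of the $A_i$ are equalities in $C_3$. For $r=3$ the index set in (c) is empty, so (c) does not occur. For $k\in\mathbb{Z}$, define the following subsets of $\mathbb{C}^*=\mathbb{C}\setminus\{0\}$: $P_k$ is the set of $x\in\mathbb{C}^*\setminus\{4\}$ satisfying both $(2x)^{-2k}(x^2-2x-\sqrt{x-4}\,x^{3/2})^{2k}=1$ and $(2x)^{-2k}(x^2-2x+\sqrt{x-4}\,x^{3/2})^{2k}=1$; $R_k$ is the set of $x\in\mathbb{C}^*\setminus\{1/4\}$ satisfying both $(2x)^{-2k}(1-2x-\sqrt{1-4x})^{2k}=1$ and $(2x)^{-2k}(1-2x+\sqrt{1-4x})^{2k}=1$; $S_k$ is the set of $x\in\mathbb{C}^*$ satisfying $x^{-2k}(1-x)^{2k}=1$. Here $\sqrt{x-4}\,x^{3/2}$ denotes a square root of $(x-4)x^3$ and $\sqrt{1-4x}$ a square root of $1-4x$; since both signs occur in the conditions, the sets do not depend on the choice. *)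

(* Defs.v *)
From HB Require Import structures.
From mathcomp Require Import all_boot all_order all_algebra all_fingroup.
From mathcomp Require Import boolp reals complex.
From mathcomp Require Import ring.

Set Implicit Arguments.
Unset Strict Implicit.
Unset Printing Implicit Defensive.

Import Order.TTheory GRing.Theory Num.Theory.

Local Open Scope ring_scope.
Local Open Scope group_scope.

Section FreeGroup.
Variable T : choiceType.

(* (x, false) stands for the letter x and (x, true) for its inverse. *)
Definition letter : Type := (T * bool)%type.
Definition linv (a : letter) : letter := (a.1, ~~ a.2).

Definition reduced (s : seq letter) := sorted (fun a b => b != linv a) s.

Record freeGroup := FreeGroup {
  fgval :> seq letter;
  fgvalP : reduced fgval }.
HB.instance Definition _ := [isSub for fgval].
HB.instance Definition _ := [Choice of freeGroup by <:].

Definition push (a : letter) (s : seq letter) :=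
  if s is b :: s' then if b == linv a then s' else a :: s else [:: a].

Lemma linvK : involutive linv.
Proof. by case=> x b; rewrite /linv /= negbK. Qed.

Lemma reduced_tl a s : reduced (a :: s) -> reduced s.
Proof. by case: s => //= b s /andP[]. Qed.

Lemma push_reduced a s : reduced s -> reduced (push a s).
Proof.
case: s => //= b s; case: ifP => [_|ne]; last by move=> rs /=; rewrite ne.
exact: (@reduced_tl b).
Qed.

Lemma pushs_reduced u v : reduced v -> reduced (foldr push v u).
Proof. by move=> rv; elim: u => //= a u IH; apply: push_reduced. Qed.

Lemma pushK a s : reduced s -> push a (push (linv a) s) = s.
Proof.
case: s => [|b s] /=; first by rewrite eqxx.
rewrite linvK; case: eqP => [->|_] rs /=; last by rewrite eqxx.
by case: s rs => //= c s /andP[/negbTE ->].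
Qed.

Lemma foldr_push a s w : reduced s -> reduced w ->
  foldr push w (push a s) = push a (foldr push w s).
Proof.
case: s => //= b s rs rw; case: ifP => //= /eqP->.
by rewrite pushK //; apply: pushs_reduced.
Qed.

Definition fg1 : freeGroup := @FreeGroup [::] isT.
Definition fgmul (u v : freeGroup) : freeGroup :=
  FreeGroup (pushs_reduced u (fgvalP v)).

Lemma fginv_subproof (u : freeGroup) : reduced (rev [seq linv a | a <- u]).
Proof.
rewrite /reduced rev_sorted sorted_map.
apply: sub_sorted (fgvalP u) => a b /=.
by apply: contra => /eqP/(can_inj linvK)->; rewrite linvK.
Qed.
Definition fginv (u : freeGroup) : freeGroup := FreeGroup (fginv_subproof u).

Lemma fgmul1g : left_id fg1 fgmul.
Proof. by move=> u; apply: val_inj. Qed.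

Lemma foldr_push_reduced s : reduced s -> foldr push [::] s = s.
Proof.
elim: s => //= a s IH rs; rewrite IH; last exact: reduced_tl rs.
by case: s rs {IH} => //= b s /andP[/negbTE->].
Qed.

Lemma fgmulg1 : right_id fg1 fgmul.
Proof. by move=> u; apply: val_inj; apply/foldr_push_reduced/fgvalP. Qed.

Lemma fgmulA : associative fgmul.
Proof.
move=> [u ru] [v rv] [w rw]; apply: val_inj => /=.
elim: u ru => //= a u IH ru.
rewrite IH; last exact: reduced_tl ru.
by rewrite foldr_push //; apply: pushs_reduced.
Qed.

Lemma fgmulVg : left_inverse fg1 fginv fgmul.
Proof.
move=> [u ru]; apply: val_inj => /=.
elim: u ru => //= a u IH ru.
rewrite rev_cons foldr_rcons /= linvK eqxx.
exact: IH (reduced_tl ru).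
Qed.

Lemma fginvK : involutive fginv.
Proof.
move=> u; apply: val_inj => /=.
by rewrite map_rev revK -map_comp (eq_map linvK) map_id.
Qed.

Lemma fgmulgV : right_inverse fg1 fginv fgmul.
Proof. by move=> u; rewrite -{1}(fginvK u) fgmulVg. Qed.

HB.instance Definition _ := isGroup.Build freeGroup
  fgmulA fgmul1g fgmulg1 fgmulVg fgmulgV.

Definition fgen (x : T) : freeGroup := @FreeGroup [:: (x, false)] isT.

Definition fglift (G : groupType) (f : T -> G) (u : freeGroup) : G :=
  foldr (fun a g => (if a.2 then (f a.1)^-1 else f a.1) * g) 1 u.

Section Lift.
Variables (G : groupType) (f : T -> G).

Lemma fglift_mul : {morph fglift f : u v / u * v}.
Proof.
move=> [u ru] [v rv]; rewrite /fglift /=.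
elim: u ru => [|a u IH] ru /=; first by rewrite mul1g.
rewrite -mulgA -IH; last exact: reduced_tl ru.
case: (foldr push v u) => [|b w] //=.
by case: eqP => [->|_] //=; case: a.2; rewrite /= ?mulVKg ?mulKg.
Qed.

Lemma fglift_gen x : fglift f (fgen x) = f x.
Proof. exact: mulg1. Qed.

End Lift.

Lemma fg_consE a s (r : reduced (a :: s)) :
  FreeGroup r = (if a.2 then (fgen a.1)^-1 else fgen a.1)
                * FreeGroup (reduced_tl r).
Proof.
apply: val_inj; case: a r => x [] /= r.
  by case: s r => //= b s /andP[/negbTE->].
by case: s r => //= b s /andP[/negbTE->].
Qed.

Lemma morph1V (G H : groupType) (f : G -> H) :
  {morph f : x y / x * y} -> (f 1 = 1) * {morph f : x / x^-1}.
Proof.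
move=> fM; have f1 : f 1 = 1 by apply: (mulgI (f 1)); rewrite -fM !mulg1.
by split=> // x; apply: (mulgI (f x)); rewrite -fM !mulgV.
Qed.

Lemma fg_morph_ext (G : groupType) (f g : freeGroup -> G) :
  {morph f : u v / u * v} -> {morph g : u v / u * v} ->
  (forall x, f (fgen x) = g (fgen x)) -> f =1 g.
Proof.
move=> fM gM fg [s]; elim: s => [|a s IH] r.
  have -> : FreeGroup r = 1 by apply: val_inj.
  by rewrite (morph1V fM) (morph1V gM).
rewrite fg_consE fM gM IH; congr (_ * _); case: a.2 => //.
by rewrite (morph1V fM) (morph1V gM) fg.
Qed.

End FreeGroup.

(* Automorphisms act on the right: [phi * psi] means first [phi], then [psi],
   as for permutations. *)

Section Autg.
Variable G : groupType.

Definition is_aut (f : G -> G) : Prop :=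
  bijective f /\ {morph f : x y / x * y}.

Record autg := Autg { autg_fun :> G -> G; autgP : `[< is_aut autg_fun >] }.
HB.instance Definition _ := [isSub for autg_fun].
HB.instance Definition _ := [Choice of autg by <:].

Implicit Types f g : autg.

Lemma autg_bij f : bijective f. Proof. by case/asboolP: (autgP f). Qed.
Lemma autg_morph f : {morph f : x y / x * y}.
Proof. by case/asboolP: (autgP f). Qed.

Lemma autg_ext f g : f =1 g -> f = g.
Proof. by move=> fg; apply: val_inj; apply: funext. Qed.

Lemma autg1_subproof : `[< is_aut (@id G) >].
Proof. by apply/asboolP; split=> //; exists id. Qed.
Definition autg1 := Autg autg1_subproof.

Lemma autg_mul_subproof f g : `[< is_aut (g \o f) >].
Proof.
apply/asboolP; split=> [|x y]; first exact: bij_comp (autg_bij g) (autg_bij f).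
by rewrite /= !autg_morph.
Qed.
Definition autg_mul f g := Autg (autg_mul_subproof f g).

Lemma autg_inv_subproof f :
  exists g : autg, cancel f g /\ cancel g f.
Proof.
have [g fK gK] := autg_bij f.
have gP : `[< is_aut g >].
  apply/asboolP; split; first by exists f.
  by move=> x y; apply: (can_inj fK); rewrite autg_morph !gK.
by exists (Autg gP).
Qed.
Definition autg_inv f : autg := sval (cid (autg_inv_subproof f)).
Lemma autg_funK f : cancel f (autg_inv f).
Proof. by rewrite /autg_inv; case: cid => g []. Qed.
Lemma autg_invK f : cancel (autg_inv f) f.
Proof. by rewrite /autg_inv; case: cid => g []. Qed.

Fact autg_mulA : associative autg_mul.
Proof. by move=> f g h; apply: autg_ext. Qed.
Fact autg_mul1 : left_id autg1 autg_mul.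
Proof. by move=> f; apply: autg_ext. Qed.
Fact autg_mulr1 : right_id autg1 autg_mul.
Proof. by move=> f; apply: autg_ext. Qed.
Fact autg_mulV : left_inverse autg1 autg_inv autg_mul.
Proof. by move=> f; apply: autg_ext => x /=; rewrite autg_invK. Qed.
Fact autg_mulrV : right_inverse autg1 autg_inv autg_mul.
Proof. by move=> f; apply: autg_ext => x /=; rewrite autg_funK. Qed.

HB.instance Definition _ := isGroup.Build autg
  autg_mulA autg_mul1 autg_mulr1 autg_mulV autg_mulrV.

Lemma autgM f g x : (f * g) x = g (f x). Proof. by []. Qed.

End Autg.

Definition F3 := freeGroup 'I_3.
HB.instance Definition _ := Group.on F3.

Definition x_ (i : 'I_3) : F3 := fgen i.

Definition conjugating (phi : autg F3) : Prop :=
  exists (Pi : 'S_3) (f : 'I_3 -> F3),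
    forall i, phi (x_ i) = (f i)^-1 * x_ (Pi i) * f i.

Definition conj_aut : {pred autg F3} := fun phi => `[< conjugating phi >].

Lemma conj_aut_closed : group_closed conj_aut.
Proof.
split; first by apply/asboolP; exists 1%g, (fun=> 1%g) => i;
  rewrite perm1 invg1 mul1g mulg1.
move=> phi psi /asboolP[p [f fE]] /asboolP[s [h hE]]; apply/asboolP.
pose k i := (psi^-1)%g (h (s^-1 i)%g).
exists (p * s^-1)%g, (fun i => (k (p i))^-1 * (psi^-1)%g (f i)) => i.
rewrite autgM fE permM.
have VM := @autg_morph _ (psi^-1)%g; have VV := (morph1V VM).2.
have psiV j : (psi^-1)%g (x_ j) = k j * x_ (s^-1 j)%g * (k j)^-1.
  rewrite -VV -[x_ (_ j)](autg_funK psi) -!VM hE permKV.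
  by rewrite !mulgA mulgV mul1g mulgK.
by rewrite !VM VV psiV !invgM !invgK !mulgA.
Qed.

Record C3 := ConjAut { C3val :> autg F3; C3valP : C3val \in conj_aut }.
HB.instance Definition _ := [isSub for C3val].
HB.instance Definition _ := [Choice of C3 by <:].
HB.instance Definition _ :=
  SubChoice_isSubGroup.Build (autg F3) conj_aut C3 conj_aut_closed.

Definition o1 : 'I_3 := @Ordinal 3 0 isT.
Definition o2 : 'I_3 := @Ordinal 3 1 isT.
Definition o3 : 'I_3 := @Ordinal 3 2 isT.

Lemma I3P (P : 'I_3 -> Prop) : P o1 -> P o2 -> P o3 -> forall i, P i.
Proof.
move=> P1 P2 P3 [[|[|[|//]]] i].
- by rewrite (_ : Ordinal i = o1) //; apply: val_inj.
- by rewrite (_ : Ordinal i = o2) //; apply: val_inj.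
- by rewrite (_ : Ordinal i = o3) //; apply: val_inj.
Qed.

Section BuildConjAut.
Variables f g : 'I_3 -> F3.
Hypothesis fK : forall i, fglift g (f i) = x_ i.
Hypothesis gK : forall i, fglift f (g i) = x_ i.
Hypothesis fJ : exists (Pi : 'S_3) (h : 'I_3 -> F3),
  forall i, f i = (h i)^-1 * x_ (Pi i) * h i.

Lemma build_autP : `[< is_aut (fglift f) >].
Proof.
apply/asboolP; split; last exact: fglift_mul.
exists (fglift g); apply: fg_morph_ext => //=.
- by move=> x y; rewrite !fglift_mul.
- by move=> i; rewrite fglift_gen fK.
- by move=> x y; rewrite !fglift_mul.
- by move=> i; rewrite fglift_gen gK.
Qed.

Lemma build_conjP : Autg build_autP \in conj_aut.
Proof.
apply/asboolP; have [p [h hE]] := fJ.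
by exists p, h => i /=; rewrite fglift_gen hE.
Qed.

Definition build_C3 : C3 := ConjAut build_conjP.
End BuildConjAut.

Definition sigma_im (i j k : 'I_3) : F3 :=
  if k == i then x_ i * x_ j * (x_ i)^-1 else if k == j then x_ i else x_ k.
Definition sigmaV_im (i j k : 'I_3) : F3 :=
  if k == i then x_ j else if k == j then (x_ j)^-1 * x_ i * x_ j else x_ k.
Definition alpha_im (i j k : 'I_3) : F3 :=
  if k == i then x_ j else if k == j then x_ i else x_ k.

Section Generators.
Variables (i j : 'I_3) (ij : i != j).

Let ji : (j == i) = false. Proof. by rewrite eq_sym (negbTE ij). Qed.

Lemma sigmaK k : fglift (sigmaV_im i j) (sigma_im i j k) = x_ k.
Proof.
have gi : fglift (sigmaV_im i j) (x_ i) = x_ j.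
  by rewrite fglift_gen /sigmaV_im eqxx.
have gj : fglift (sigmaV_im i j) (x_ j) = (x_ j)^-1 * x_ i * x_ j.
  by rewrite fglift_gen /sigmaV_im ji eqxx.
rewrite /sigma_im; case: (eqVneq k i) => [->|ki].
  rewrite !fglift_mul (morph1V (fglift_mul _)) gi gj.
  by rewrite !mulgA mulgV mul1g mulgK.
case: (eqVneq k j) => [->|kj]; first by rewrite gi.
by rewrite fglift_gen /sigmaV_im (negbTE ki) (negbTE kj).
Qed.

Lemma sigmaVK k : fglift (sigma_im i j) (sigmaV_im i j k) = x_ k.
Proof.
have gi : fglift (sigma_im i j) (x_ i) = x_ i * x_ j * (x_ i)^-1.
  by rewrite fglift_gen /sigma_im eqxx.
have gj : fglift (sigma_im i j) (x_ j) = x_ i.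
  by rewrite fglift_gen /sigma_im ji eqxx.
rewrite /sigmaV_im; case: (eqVneq k i) => [->|ki]; first by rewrite gj.
case: (eqVneq k j) => [->|kj].
  rewrite !fglift_mul (morph1V (fglift_mul _)) gi gj.
  by rewrite !mulgA mulVg mul1g mulgVK.
by rewrite fglift_gen /sigma_im (negbTE ki) (negbTE kj).
Qed.

Lemma sigmaJ : exists (Pi : 'S_3) (h : 'I_3 -> F3),
  forall k, sigma_im i j k = (h k)^-1 * x_ (Pi k) * h k.
Proof.
exists (tperm i j), (fun k => if k == i then (x_ i)^-1 else 1) => k.
rewrite /sigma_im; case: tpermP => [->|->|/eqP/negbTE-> /eqP/negbTE->].
- by rewrite eqxx invgK.
- by rewrite ji eqxx invg1 mul1g mulg1.
- by rewrite invg1 mul1g mulg1.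
Qed.

Lemma alphaK k : fglift (alpha_im i j) (alpha_im i j k) = x_ k.
Proof.
rewrite {2}/alpha_im; case: (eqVneq k i) => [->|ki].
  by rewrite fglift_gen /alpha_im ji eqxx.
case: (eqVneq k j) => [->|kj]; rewrite fglift_gen /alpha_im ?eqxx //.
by rewrite (negbTE ki) (negbTE kj).
Qed.

Lemma alphaJ : exists (Pi : 'S_3) (h : 'I_3 -> F3),
  forall k, alpha_im i j k = (h k)^-1 * x_ (Pi k) * h k.
Proof.
exists (tperm i j), (fun=> 1) => k; rewrite invg1 mul1g mulg1 /alpha_im.
case: tpermP => [->|->|/eqP/negbTE-> /eqP/negbTE->] //; rewrite ?eqxx //.
by rewrite ji.
Qed.

(* x_i |-> x_i x_j x_i^-1, x_j |-> x_i, the third generator being fixed. *)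
Definition sigma_ : C3 := build_C3 sigmaK sigmaVK sigmaJ.

(* x_i <-> x_j, the third generator being fixed. *)
Definition alpha_ : C3 := build_C3 alphaK alphaK alphaJ.

End Generators.

Definition sigma1 : C3 := @sigma_ o1 o2 isT.
Definition sigma2 : C3 := @sigma_ o2 o3 isT.
Definition alpha1 : C3 := @alpha_ o1 o2 isT.
Definition alpha2 : C3 := @alpha_ o2 o3 isT.

Lemma C3_ext (u v : C3) : (forall i, u (x_ i) = v (x_ i)) -> u = v.
Proof.
move=> uv; apply: val_inj; apply: autg_ext.
by apply: fg_morph_ext => //; apply: autg_morph.
Qed.

(* The relations of the presentation of C_3. They depend on the convention for
   products and on the choice of the sigma's. *)
Lemma C3_relations :
  [/\ sigma1 * sigma2 * sigma1 = sigma2 * sigma1 * sigma2,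
      alpha1 * alpha1 = 1 /\ alpha2 * alpha2 = 1,
      alpha1 * alpha2 * alpha1 = alpha2 * alpha1 * alpha2,
      sigma1 * alpha2 * alpha1 = alpha2 * alpha1 * sigma2 &
      sigma2 * sigma1 * alpha2 = alpha1 * sigma2 * sigma1].
Proof.
split; [|split|..]; apply: C3_ext; elim/I3P; apply: val_inj;
  by vm_compute.
Qed.

Definition T : C3 := sigma2 * alpha2 * alpha1.

Variant generator := Sigma1 | Sigma2 | Alpha1 | Alpha2.

Definition gen_code (g : generator) : 'I_4 :=
  match g with
  | Sigma1 => @Ordinal 4 0 isT | Sigma2 => @Ordinal 4 1 isT
  | Alpha1 => @Ordinal 4 2 isT | Alpha2 => @Ordinal 4 3 isT
  end.
Lemma gen_code_inj : injective gen_code. Proof. by do 2!case. Qed.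
HB.instance Definition _ := Equality.copy generator (inj_type gen_code_inj).

Definition gen_val (g : generator) : C3 :=
  match g with
  | Sigma1 => sigma1 | Sigma2 => sigma2 | Alpha1 => alpha1 | Alpha2 => alpha2
  end.

(* [:: (g1, e1); ...; (gn, en)] stands for g1 ^ e1 ... gn ^ en. *)
Definition word := seq (generator * int).

Definition zpow (G : groupType) (x : G) (e : int) : G :=
  match e with Posz n => x ^+ n | Negz n => x ^- n.+1 end.

Definition eval (w : word) : C3 := \prod_(a <- w) zpow (gen_val a.1) a.2.

Definition wlength (w : word) : nat := (\sum_(a <- w) `|a.2|)%N.

Definition alpha_words : seq word :=
  [:: [:: (Alpha1, 1%Z)]; [:: (Alpha2, 1%Z)];
      [:: (Alpha1, 1%Z); (Alpha2, 1%Z)]; [:: (Alpha2, 1%Z); (Alpha1, 1%Z)];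
      [:: (Alpha1, 1%Z); (Alpha2, 1%Z); (Alpha1, 1%Z)] ].

Section GL.
Variables (K : comUnitRingType) (n : nat).

Record GL := MkGL { GLval :> 'M[K]_n; GLvalP : GLval \in unitmx }.
HB.instance Definition _ := [isSub for GLval].
HB.instance Definition _ := [Choice of GL by <:].

Definition GL1 : GL := MkGL (unitmx1 K n).
Lemma GLmul_subproof (A B : GL) : A *m B \in unitmx.
Proof. by rewrite unitmx_mul !GLvalP. Qed.
Definition GLmul (A B : GL) : GL := MkGL (GLmul_subproof A B).
Lemma GLinv_subproof (A : GL) : invmx A \in unitmx.
Proof. by rewrite unitmx_inv GLvalP. Qed.
Definition GLinv (A : GL) : GL := MkGL (GLinv_subproof A).

Fact GLmulA : associative GLmul.
Proof. by move=> A B D; apply: val_inj; apply: mulmxA. Qed.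
Fact GLmul1 : left_id GL1 GLmul.
Proof. by move=> A; apply: val_inj; apply: mul1mx. Qed.
Fact GLmulr1 : right_id GL1 GLmul.
Proof. by move=> A; apply: val_inj; apply: mulmx1. Qed.
Fact GLmulV : left_inverse GL1 GLinv GLmul.
Proof. by move=> A; apply: val_inj; apply/mulVmx/GLvalP. Qed.
Fact GLmulrV : right_inverse GL1 GLinv GLmul.
Proof. by move=> A; apply: val_inj; apply/mulmxV/GLvalP. Qed.

HB.instance Definition _ := isGroup.Build GL
  GLmulA GLmul1 GLmulr1 GLmulV GLmulrV.

End GL.

Section Rho.
Local Open Scope ring_scope.
Variables (K : fieldType) (q : K).

Definition mx3 (rows : seq (seq K)) : 'M[K]_3 :=
  \matrix_(i < 3, j < 3) nth 0 (nth [::] rows i) j.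

Definition rho_sigma1 : 'M[K]_3 :=
  mx3 [:: [:: q ^+ 2;      0;     0];
          [:: q * (q - 1); 1 - q; q];
          [:: 0;           1;     0]].

Definition rho_sigma2 : 'M[K]_3 :=
  mx3 [:: [:: 1 - q; q; q * (q - 1)];
          [:: 1;     0; 0];
          [:: 0;     0; q ^+ 2]].

Definition rho_alpha1 : 'M[K]_3 :=
  mx3 [:: [:: 1; 0; 0];
          [:: 0; 0; 1];
          [:: 0; 1; 0]].

Definition rho_alpha2 : 'M[K]_3 :=
  mx3 [:: [:: 0; 1; 0];
          [:: 1; 0; 0];
          [:: 0; 0; 1]].

(* Since sigma1, sigma2, alpha1, alpha2 generate C_3, at most one homomorphism
   satisfies this; [rho_exists] below shows that there is one. *)
Definition is_rho (rho : {multiplicative C3 -> GL K 3}) : Prop :=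
  [/\ rho sigma1 = rho_sigma1 :> 'M_3, rho sigma2 = rho_sigma2 :> 'M_3,
      rho alpha1 = rho_alpha1 :> 'M_3 & rho alpha2 = rho_alpha2 :> 'M_3].

End Rho.

Section ExcludedSets.
Local Open Scope ring_scope.
Variable C : numClosedFieldType.

(* [sqrtC] is one fixed square root; both signs occur. *)
Definition P_ (k : int) (x : C) : Prop :=
  let s := sqrtC ((x - 4) * x ^+ 3) in
  [/\ x != 0, x != 4,
      (2 * x) ^ (- (2 * k)) * (x ^+ 2 - 2 * x - s) ^ (2 * k) = 1 &
      (2 * x) ^ (- (2 * k)) * (x ^+ 2 - 2 * x + s) ^ (2 * k) = 1].

Definition R_ (k : int) (x : C) : Prop :=
  let s := sqrtC (1 - 4 * x) in
  [/\ x != 0, x != 4^-1,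
      (2 * x) ^ (- (2 * k)) * (1 - 2 * x - s) ^ (2 * k) = 1 &
      (2 * x) ^ (- (2 * k)) * (1 - 2 * x + s) ^ (2 * k) = 1].

(* At x = 1 and k < 0 the left-hand side is 0 here, because 0^-1 = 0. *)
Definition S_ (k : int) (x : C) : Prop :=
  x != 0 /\ x ^ (- (2 * k)) * (1 - x) ^ (2 * k) = 1.

End ExcludedSets.

(* Existence of rho.  If D : F_3 -> K^3 is the vector of Fox derivatives specialized at
    x_i = q, then phi |-> L(phi), with rows D(phi(x_i)), is a representation
    of C_3 in which all the row sums are 1. The representation rho is the
    symmetric square of its restriction to the plane of vectors of sum 0, in
    the basis (e_1 - e_2)^2, (e_1 - e_3)^2, (e_2 - e_3)^2. *)

Lemma freeGroup_ind (A : choiceType) (P : freeGroup A -> Prop) :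
  P 1 -> (forall x u, P u -> P (fgen x * u)) ->
  (forall x u, P u -> P ((fgen x)^-1 * u)) -> forall u, P u.
Proof.
move=> P1 Pg Pv [s]; elim: s => [|a s IH] r.
  by rewrite (_ : FreeGroup r = 1) //; apply: val_inj.
rewrite fg_consE; case: a.2; [exact: Pv | exact: Pg].
Qed.

Section RhoExists.
Local Open Scope ring_scope.
Variables (K : fieldType) (q : K).
Hypothesis q0 : q != 0.

Let wt (a : letter 'I_3) : K := if a.2 then q^-1 else q.
Let dl (a : letter 'I_3) : 'rV[K]_3 :=
  if a.2 then - q^-1 *: delta_mx 0 a.1 else delta_mx 0 a.1.

Let Ws (s : seq (letter 'I_3)) : K := foldr (fun a c => wt a * c) 1 s.
Let Ds (s : seq (letter 'I_3)) : 'rV[K]_3 :=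
  foldr (fun a v => dl a + wt a *: v) 0 s.
Let W (u : F3) := Ws u.
Let D : F3 -> 'rV[K]_3 := locked (fun u => Ds u).

Let wtV a : wt a * wt (linv a) = 1.
Proof. by rewrite /wt /=; case: a.2 => /=; rewrite ?mulVf ?mulfV. Qed.
Let dlV a : dl a + wt a *: dl (linv a) = 0.
Proof.
rewrite /dl /wt /=; case: a.2 => /=; first by rewrite scaleNr addNr.
by rewrite scalerA mulrN mulfV // scaleN1r addrN.
Qed.

Let Ws_push a s : Ws (push a s) = wt a * Ws s.
Proof.
case: s => //= b s; case: eqP => //= ->.
by rewrite mulrA wtV mul1r.
Qed.
Let Ds_push a s : Ds (push a s) = dl a + wt a *: Ds s.
Proof.
case: s => //= b s; case: eqP => //= ->.
by rewrite scalerDr scalerA wtV scale1r addrA dlV add0r.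
Qed.

Let WM u v : W (u * v)%g = W u * W v.
Proof.
rewrite /W /=; elim: (fgval u) => [|a s IH] /=; first by rewrite mul1r.
by rewrite Ws_push IH mulrA.
Qed.
Let DM u v : D (u * v)%g = D u + W u *: D v.
Proof.
rewrite /W /D -lock /=; elim: (fgval u) => [|a s IH] /=.
  by rewrite scale1r add0r.
by rewrite Ds_push IH scalerDr scalerA addrA.
Qed.
Let W1 : W 1%g = 1. Proof. by []. Qed.
Let D1 : D 1%g = 0. Proof. by rewrite /D -lock. Qed.
Let Wx i : W (x_ i) = q. Proof. by rewrite /W /= mulr1. Qed.
Let Dx i : D (x_ i) = delta_mx 0 i. Proof. by rewrite /D -lock /= scaler0 addr0. Qed.
Let WV u : W u^-1%g = (W u)^-1.
Proof.
have e : W u * W u^-1%g = 1 by rewrite -WM mulgV.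
have Wu0 : W u != 0.
  by apply/eqP=> u0; move/eqP: e; rewrite u0 mul0r eq_sym oner_eq0.
by apply: (mulfI Wu0); rewrite e mulfV.
Qed.
Let W0 u : W u != 0.
Proof.
apply/eqP=> u0; have /eqP : W u * W u^-1%g = 1 by rewrite -WM mulgV.
by rewrite u0 mul0r eq_sym oner_eq0.
Qed.
Let DV u : D u^-1%g = - (W u)^-1 *: D u.
Proof.
have : D (u^-1 * u)%g = 0 by rewrite mulVg.
by rewrite DM WV scaleNr => /eqP; rewrite addr_eq0 => /eqP.
Qed.

Let sm (v : 'rV[K]_3) : K := v 0 o1 + v 0 o2 + v 0 o3.
Let smD u v : sm (u + v) = sm u + sm v.
Proof. by rewrite /sm !mxE; ring. Qed.
Let smZ c v : sm (c *: v) = c * sm v.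
Proof. by rewrite /sm !mxE; ring. Qed.
Let smx i : sm (delta_mx 0 i) = 1.
Proof. by elim/I3P: i; rewrite /sm !mxE /=; ring. Qed.

Let smDw u : (q - 1) * sm (D u) = W u - 1.
Proof.
elim/freeGroup_ind: u => [|i u IH|i u IH].
- by rewrite D1 /sm !mxE W1; ring.
- by rewrite DM WM Dx Wx smD smZ smx mulrDr mulrCA IH; ring.
- rewrite DM WM DV WV Dx Wx smD !smZ smx mulrDr (mulrCA (q - 1) q^-1) IH.
  by field.
Qed.

Let L (phi : C3) : 'M[K]_3 := \matrix_i D (phi (x_ i)).

Let C3J (phi : C3) i : exists j f, phi (x_ i) = (f^-1 * x_ j * f)%g.
Proof.
by have /asboolP[p [f fE]] := C3valP phi; exists (p i), (f i).
Qed.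
Let C3M (phi : C3) : {morph phi : u v / (u * v)%g}.
Proof. exact: autg_morph. Qed.

Let W_phi phi u : W ((phi : C3) u) = W u.
Proof.
have Wg i : W (phi (x_ i)) = q.
  by have [j [f ->]] := C3J phi i; rewrite !WM WV Wx mulrAC mulVf ?mul1r.
elim/freeGroup_ind: u => [|i u IH|i u IH].
- by rewrite (morph1V (C3M phi)).
- by rewrite C3M !WM IH Wg Wx.
- by rewrite C3M (morph1V (C3M phi)) !WM !WV IH Wg Wx.
Qed.

Let D_phi phi u : D ((phi : C3) u) = D u *m L phi.
Proof.
have Dg i : D (phi (x_ i)) = D (x_ i) *m L phi by rewrite Dx -rowE rowK.
elim/freeGroup_ind: u => [|i u IH|i u IH].
- by rewrite (morph1V (C3M phi)) D1 mul0mx.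
- by rewrite C3M !DM IH Dg W_phi Dx Wx mulmxDl scalemxAl.
- rewrite C3M (morph1V (C3M phi)) !DM !DV !WV IH Dg W_phi Dx Wx mulmxDl.
  by rewrite !scalemxAl.
Qed.

Let L_sum phi i : L phi i o1 + L phi i o2 + L phi i o3 = 1.
Proof.
have [j [f fE]] := C3J phi i.
have -> : L phi i o1 + L phi i o2 + L phi i o3 = sm (D (phi (x_ i))).
  by rewrite /sm !mxE.
rewrite fE !DM WM !WV Wx DV Dx !smD !smZ smx.
apply: (mulfI (W0 f)).
rewrite (_ : W f * _ = 1 + (q - 1) * sm (D f)); last by field; apply: W0.
by rewrite smDw; ring.
Qed.

Let LM phi psi : L (phi * psi)%g = L phi *m L psi.
Proof.
apply/row_matrixP => i; rewrite row_mul !rowK.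
by rewrite -D_phi.
Qed.

Let sq (v : 'rV[K]_3) : 'rV[K]_3 :=
  \row_j (- (v 0 (nth o1 [:: o1; o1; o2] j)
             * v 0 (nth o1 [:: o2; o3; o3] j))).
Let pr (M : 'M[K]_3) : 'M[K]_3 :=
  \matrix_i (row (nth o1 [:: o1; o1; o2] i) M
             - row (nth o1 [:: o2; o3; o3] i) M).
Let Sq (M : 'M[K]_3) : 'M[K]_3 := \matrix_i sq (row i (pr M)).

Let sum3 (F : 'I_3 -> K) : \sum_i F i = F o1 + F o2 + F o3.
Proof.
rewrite !big_ord_recl big_ord0 addr0 addrA.
by congr (F _ + F _ + F _); apply: val_inj.
Qed.

Let SqM phi psi : Sq (L (phi * psi)%g) = Sq (L phi) *m Sq (L psi).
Proof.
rewrite LM; have s := L_sum phi; move: (L phi) (L psi) s => A B s.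
have s' i : A i o3 = 1 - A i o1 - A i o2 by rewrite -(s i); ring.
apply/matrixP => i j; rewrite !mxE !sum3 !mxE.
by elim/I3P: i; elim/I3P: j; rewrite /= !s'; ring.
Qed.

Let Sq1 : Sq (L 1%g) = 1%:M.
Proof.
have -> : L 1%g = 1%:M.
  by apply/row_matrixP => i; rewrite rowK row1 /= Dx.
apply/matrixP => i j; rewrite !mxE.
by elim/I3P: i; elim/I3P: j; rewrite /=; ring.
Qed.

Let Sq_unit phi : Sq (L phi) \in unitmx.
Proof.
have /mulmx1_unit[] // : Sq (L phi) *m Sq (L phi^-1%g) = 1%:M.
by rewrite -SqM mulgV Sq1.
Qed.

Let rho0 (phi : C3) : GL K 3 := MkGL (Sq_unit phi).
Let rho0M : {morph rho0 : x y / (x * y)%g}.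
Proof. by move=> x y; apply: val_inj; apply: SqM. Qed.
HB.instance Definition _ :=
  isMultiplicative.Build C3 (GL K 3) rho0 rho0M.

Let Lgen (phi : C3) (u1 u2 u3 : F3) :
  phi (x_ o1) = u1 -> phi (x_ o2) = u2 -> phi (x_ o3) = u3 ->
  Sq (L phi) = Sq (\matrix_i D (nth 1%g [:: u1; u2; u3] i)).
Proof.
move=> e1 e2 e3; congr Sq; apply/row_matrixP; elim/I3P; rewrite !rowK /=.
- by rewrite e1.
- by rewrite e2.
- by rewrite e3.
Qed.

Lemma rho_exists : exists rho, is_rho q rho.
Proof.
exists (rho0 : {multiplicative C3 -> GL K 3}); split=> /=.
- apply: (etrans (@Lgen sigma1 (x_ o1 * x_ o2 * (x_ o1)^-1)%g (x_ o1) (x_ o3)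
    (fglift_gen _ _) (fglift_gen _ _) (fglift_gen _ _))).
  apply/matrixP => i j; rewrite !mxE.
  elim/I3P: i; elim/I3P: j;
    rewrite /= ?(DM, WM, DV, WV, Dx, Wx) ?mxE /=; by field.
- apply: (etrans (@Lgen sigma2 (x_ o1) (x_ o2 * x_ o3 * (x_ o2)^-1)%g (x_ o2)
    (fglift_gen _ _) (fglift_gen _ _) (fglift_gen _ _))).
  apply/matrixP => i j; rewrite !mxE.
  elim/I3P: i; elim/I3P: j;
    rewrite /= ?(DM, WM, DV, WV, Dx, Wx) ?mxE /=; by field.
- apply: (etrans (@Lgen alpha1 (x_ o2) (x_ o1) (x_ o3)
    (fglift_gen _ _) (fglift_gen _ _) (fglift_gen _ _))).
  apply/matrixP => i j; rewrite !mxE.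
  elim/I3P: i; elim/I3P: j; rewrite /= ?Dx ?mxE /=; by ring.
- apply: (etrans (@Lgen alpha2 (x_ o1) (x_ o3) (x_ o2)
    (fglift_gen _ _) (fglift_gen _ _) (fglift_gen _ _))).
  apply/matrixP => i j; rewrite !mxE.
  elim/I3P: i; elim/I3P: j; rewrite /= ?Dx ?mxE /=; by ring.
Qed.

End RhoExists.

(* Main.v *)
Require Import Defs.
From mathcomp Require Import all_boot all_order all_algebra all_fingroup.
From mathcomp Require Import boolp reals complex.
From mathcomp Require Import ring zify.

(** In the representation rho, T^2 acts as the scalar q^2, so even powers of T
    are central.  Hence factors A_j on the left and A_j^-1 on the right of a
    relation A_1 T ... T A_r = T^(r-1) can be peeled off.  In case (b) this
    leaves rho(A_i) = 1 for the middle index i, which is absurd.  In cases (a)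
    and (c) it leaves (rho(T) b)^(2n) = q^(2n) with n > 0 and b the image of an
    alpha-word; then every eigenvalue z of rho(T) b satisfies z^(2n) = q^(2n).
    For three of the words 1 or q^2 is an eigenvalue, making q a root of unity;
    for alpha_2 and alpha_1 alpha_2 alpha_1 the eigenvalues put q in P_(2n) and
    R_(2n), except at q = 4 and q = 1/4, where rho(T) b is q times a nontrivial
    unipotent matrix. *)

Set Implicit Arguments.
Unset Strict Implicit.
Unset Printing Implicit Defensive.

Import Order.TTheory GRing.Theory Num.Theory.

(** * Words alternating with an element [t] whose square is central *)

Section Peeling.
Local Open Scope group_scope.
Variables (G : groupType) (t : G).
Hypothesis ttC : forall g, commute g (t * t).

Lemma even_expg_commute n g : commute g (t ^+ n.*2).
Proof. by rewrite -mul2n expgM; apply: commuteX; apply: ttC. Qed.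

(** The last letter carries no trailing [t]; with both ends as indices, dropping a letter at each
    end leaves a [tword] of the same sequence. *)
Definition tword (a : nat -> G) lo hi : G :=
  \prod_(lo <= i < hi) (a i * t) * a hi.

Lemma twordE a lo hi : (lo < hi)%N ->
  tword a lo hi.+1 = a lo * t * tword a lo.+1 hi * t * a hi.+1.
Proof.
move=> lh; rewrite /tword big_ltn; last by lia.
by rewrite big_nat_recr /= ?mulgA //; lia.
Qed.

(** With outer letters d and d^-1, the relation reads d (t w t) d^-1 = t^(2m). The right side is
    central, so the conjugation by d disappears; cancelling one t on each side leaves w = t^(2m-2),
    the same relation for a shorter word. *)
Lemma tword_peel a k lo n :
  (forall j, (j < k)%N -> a (lo + (n + k).*2 - j)%N * a (lo + j)%N = 1) ->
  tword a lo (lo + (n + k).*2) = t ^+ (n + k).*2 ->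
  tword a (lo + k) (lo + k + n.*2) = t ^+ n.*2.
Proof.
elim: k lo => [|k IH] lo aV; first by rewrite !addn0.
have hiE : (lo + (n + k.+1).*2 = (lo.+1 + (n + k).*2).+1)%N by lia.
rewrite hiE twordE; last by lia.
move=> e; rewrite -addSnnS; apply: IH => [j jk|].
  have := aV j.+1 jk; congr (a _ * a _ = 1); lia.
have := aV 0%N isT; rewrite addn0 subn0 hiE.
move: (tword _ _ _) (a _.+1) (a lo) e => w c d e cd.
have {cd} cE : c = d^-1 by apply: (mulIg d); rewrite cd mulVg.
have {e} : t * w * t = t ^+ (n + k.+1).*2.
  have := @even_expg_commute (n + k.+1) d; rewrite /commute -e cE => eC.
  apply: (mulgI d); rewrite eC -!mulgA mulVg mulg1 !mulgA.
  by rewrite -[RHS]mulgA ?mulgA.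
rewrite addnS doubleS expgSr expgS => e.
by apply: (mulgI t); apply: (mulIg t).
Qed.

(** Conjugation by the first letter fixes the central t^(2n) and moves that letter to the end, where
    it joins the last one to form b; the word becomes (t b)^(2n). *)
Lemma tword_const a b lo n : (0 < n)%N ->
  (forall j, (lo < j < lo + n.*2)%N -> a j = b) -> a (lo + n.*2)%N * a lo = b ->
  tword a lo (lo + n.*2) = t ^+ n.*2 -> (t * b) ^+ n.*2 = t ^+ n.*2.
Proof.
case: n => // n _ ab aE; rewrite /tword big_ltn; last by lia.
have -> : \prod_(lo.+1 <= i < lo + n.+1.*2) (a i * t) = (b * t) ^+ n.*2.+1.
  rewrite (eq_big_nat _ _ (F2 := fun=> b * t)) => [|i hi]; last by rewrite ab.
  by rewrite prodg_const_nat; congr (_ ^+ _); lia.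
have powE k : (t * b) ^+ k.+1 = t * (b * t) ^+ k * b.
  elim: k => [|k IH]; first by rewrite mulg1.
  by rewrite expgSr IH expgSr !mulgA.
move=> e; apply: (mulgI (a lo)); rewrite even_expg_commute -e doubleS powE.
by rewrite -aE doubleS !mulgA.
Qed.

End Peeling.

(** * Explicit 3 x 3 matrices, eigenvectors and Jordan chains *)

Section Matrices.
Local Open Scope ring_scope.
Variable K : fieldType.
Implicit Types q c z : K.

Definition row3 (x y z : K) : 'rV[K]_3 := \row_j nth 0 [:: x; y; z] j.

Lemma sum_I3 (F : 'I_3 -> K) : \sum_i F i = F o1 + F o2 + F o3.
Proof.
rewrite !big_ord_recl big_ord0 addr0 addrA.
by congr (F _ + F _ + F _); apply: val_inj.
Qed.

Lemma row3_mul x y z a b c d e f g h i :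
  row3 x y z *m mx3 [:: [:: a; b; c]; [:: d; e; f]; [:: g; h; i]] =
  row3 (x * a + y * d + z * g) (x * b + y * e + z * h) (x * c + y * f + z * i).
Proof. by apply/rowP => j; rewrite !mxE !sum_I3 !mxE; elim/I3P: j. Qed.

Lemma row3Z c x y z : c *: row3 x y z = row3 (c * x) (c * y) (c * z).
Proof. by apply/rowP => j; rewrite !mxE; elim/I3P: j. Qed.

Lemma row3D x y z x' y' z' :
  row3 x y z + row3 x' y' z' = row3 (x + x') (y + y') (z + z').
Proof. by apply/rowP => j; rewrite !mxE; elim/I3P: j. Qed.

Lemma row3_eq0 x y z : (row3 x y z == 0) = [&& x == 0, y == 0 & z == 0].
Proof.
apply/eqP/and3P => [/rowP e|[/eqP-> /eqP-> /eqP->]].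
  by have := (e o1, e o2, e o3); rewrite !mxE /= => -[[-> ->] ->]; rewrite eqxx.
by apply/rowP; elim/I3P; rewrite !mxE.
Qed.

Lemma mx3_mul a b c d e f g h i a' b' c' d' e' f' g' h' i' :
  mx3 [:: [:: a; b; c]; [:: d; e; f]; [:: g; h; i]] *m
  mx3 [:: [:: a'; b'; c']; [:: d'; e'; f']; [:: g'; h'; i']] =
  mx3 [:: [:: a * a' + b * d' + c * g'; a * b' + b * e' + c * h';
              a * c' + b * f' + c * i'];
          [:: d * a' + e * d' + f * g'; d * b' + e * e' + f * h';
              d * c' + e * f' + f * i'];
          [:: g * a' + h * d' + i * g'; g * b' + h * e' + i * h';
              g * c' + h * f' + i * i']].
Proof.
apply/matrixP => j k; rewrite !mxE !sum_I3 !mxE.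
by elim/I3P: j; elim/I3P: k.
Qed.

Lemma eigen_exp m (M : 'M[K]_3) (v : 'rV[K]_3) c z :
  v != 0 -> v *m M = z *: v -> M ^+ m = c%:M -> z ^+ m = c.
Proof.
move=> v0 vM Mm; have : v *m M ^+ m = z ^+ m *: v.
  elim: m {Mm} => [|m IH]; first by rewrite mulmx1 scale1r.
  by rewrite exprSr -mulmxE mulmxA IH -scalemxAl vM scalerA -exprSr.
rewrite Mm mul_mx_scalar => /eqP.
by rewrite -subr_eq0 -scalerBl scaler_eq0 (negbTE v0) orbF subr_eq0 => /eqP.
Qed.

(** On the span of v and w, M^m sends w to z^m (w + m v), so a scalar power forces m v = 0. In
    characteristic 0 this excludes m > 0 when a multiple eigenvalue makes [eigen_exp]
    uninformative. *)
Lemma jordan_exp m (M : 'M[K]_3) (v w : 'rV[K]_3) z :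
  v != 0 -> z != 0 -> v *m M = z *: v -> w *m M = z *: (w + v) ->
  M ^+ m = (z ^+ m)%:M -> m%:R = 0 :> K.
Proof.
move=> v0 z0 vM wM Mm; have : w *m M ^+ m = z ^+ m *: (w + m%:R *: v).
  elim: m {Mm} => [|m IH]; first by rewrite mulmx1 scale1r scale0r addr0.
  rewrite exprSr -mulmxE mulmxA IH -scalemxAl mulmxDl -scalemxAl vM wM.
  rewrite (exprSr z) -scalerA; congr (_ *: _).
  rewrite scalerA mulrC -scalerA -scalerDr; congr (_ *: _).
  by rewrite -addrA mulrS scalerDl scale1r.
rewrite Mm mul_mx_scalar => /eqP.
rewrite -subr_eq0 -scalerBr scaler_eq0 expf_eq0 (negbTE z0) andbF /=.
by rewrite opprD addNKr oppr_eq0 scaler_eq0 (negbTE v0) orbF => /eqP.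
Qed.

Definition rho_T q : 'M[K]_3 := rho_sigma2 q *m rho_alpha2 K *m rho_alpha1 K.

Definition rho_alphas : seq 'M[K]_3 :=
  [:: rho_alpha1 K; rho_alpha2 K; rho_alpha1 K *m rho_alpha2 K;
      rho_alpha2 K *m rho_alpha1 K;
      rho_alpha1 K *m rho_alpha2 K *m rho_alpha1 K].

Lemma rho_TT q : rho_T q *m rho_T q = (q ^+ 2)%:M.
Proof.
rewrite /rho_T !mx3_mul; apply/matrixP => i j; rewrite !mxE.
by elim/I3P: i; elim/I3P: j; rewrite /=; ring.
Qed.

Lemma rho_alphas_neq1 b : b \in rho_alphas -> b != 1%:M.
Proof.
rewrite !inE => ba; apply/eqP => b1; suff: (1 : K) = 0 by apply/eqP/oner_neq0.
(* A nontrivial permutation matrix of size 3 fixes at most one index, so one of these two diagonal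
   entries is 0. *)
have := (congr1 (fun M : 'M[K]_3 => (M o1 o1, M o2 o2)) b1).
case/or4P: ba => [/eqP->|/eqP->|/eqP->|/orP[]/eqP->];
  rewrite ?mx3_mul !mxE /= ?(mulr0, mul0r, mulr1, addr0, add0r) => -[].
all: by do 1?[by move=> -> | by move=> _ ->].
Qed.

Lemma rho_T_exp n q : rho_T q ^+ n.*2 = ((q ^+ n) ^+ 2)%:M.
Proof.
rewrite -mul2n exprM expr2 -mulmxE rho_TT -rmorphXn /=.
by rewrite -!exprM mulnC.
Qed.

End Matrices.

(** * Eigenvalues of rho(T) b and the excluded values of q *)

Section Scalars.
Local Open Scope ring_scope.
Variable C : numClosedFieldType.
Variable q : C.
Hypothesis q_neq0 : q != 0.
Hypothesis hq6 : forall k : int, k != 0 -> q ^ (6 * k) != 1.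
Hypothesis hPR : forall m : int, m != 0 -> (2 %| m)%Z -> ~ (P_ m q \/ R_ m q).

Lemma not_root_unity n : (0 < n)%N -> q ^+ n != 1.
Proof.
move=> n0; apply/eqP => qn.
have /eqP[] : q ^ (6 * n%:Z) != 1 by apply: hq6; lia.
by rewrite mulrC -exprz_exp -exprnP qn exp1rz.
Qed.

(** The conditions of [P_] and [R_] contain 2z for a root z of a quadratic. With k = 2n their
    exponent is 4n, so the relation enters squared and the powers of 2 cancel. *)
Lemma half_exp_eq1 n z : z ^+ n.*2 = q ^+ n.*2 ->
  (2 * q) ^ (- (2 * n.*2%:Z)) * (2 * z) ^ (2 * n.*2%:Z) = 1.
Proof.
move=> zq; have -> : 2 * n.*2%:Z = (n.*2 * 2)%N%:Z by lia.
rewrite -invr_expz -!exprnP !exprMn !(exprM z) !(exprM q) zq.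
by rewrite mulVf // mulf_eq0 !expf_eq0 pnatr_eq0 (negbTE q_neq0) !andbF.
Qed.

(** The eigenvalues are q and the roots of z^2 - (q^2 - 2q) z + q^2, whose discriminant is (q - 4)
    q^3. *)
Lemma rho_T_alpha2_exp n : (0 < n)%N ->
  (rho_T q *m rho_alpha2 C) ^+ n.*2 <> (q ^+ n.*2)%:M.
Proof.
move=> n0 Mn; have [q4|qn4] := eqVneq q 4.
  (* At q = 4 the quadratic has the double root q; the rows below are the start of a Jordan
     chain. *)
  suff /eqP : n.*2%:R = 0 :> C by rewrite pnatr_eq0 double_eq0 eqn0Ngt n0.
  apply: (jordan_exp (v := row3 2 2 (-1)) (w := row3 1 (-1) 0) _ q_neq0 _ _ Mn).
  - by rewrite row3_eq0 pnatr_eq0.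
  - by rewrite /rho_T !mx3_mul row3_mul row3Z q4; congr row3; ring.
  - by rewrite /rho_T !mx3_mul row3_mul row3D row3Z q4; congr row3; ring.
pose s := sqrtC ((q - 4) * q ^+ 3).
have root_exp z : z ^+ 2 = (q ^+ 2 - 2 * q) * z - q ^+ 2 ->
    z ^+ n.*2 = q ^+ n.*2.
  (* The last two coordinates of the eigenvector equation hold identically, the first by the
     quadratic, which also excludes z = 0. *)
  move=> z2; apply: (eigen_exp (v := row3 (z ^+ 2) (q * z) ((1 - q) * z + q)))
    Mn.
    rewrite row3_eq0 expf_eq0 /=; apply/negP => /and3P[/eqP z0 _ _].
    move/eqP: z2; rewrite z0 expr0n mulr0 sub0r eq_sym oppr_eq0 expf_eq0 /=.
    exact/negP.
  rewrite /rho_T !mx3_mul row3_mul row3Z; congr row3; by ring: z2.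
have sE e : e ^+ 2 = (q - 4) * q ^+ 3 ->
    (2 * q) ^ (- (2 * n.*2%:Z)) * (q ^+ 2 - 2 * q + e) ^ (2 * n.*2%:Z) = 1.
  move=> e2; have -> : q ^+ 2 - 2 * q + e = 2 * ((q ^+ 2 - 2 * q + e) / 2).
    by field.
  by apply/half_exp_eq1/root_exp; field: e2.
have s2 : s ^+ 2 = (q - 4) * q ^+ 3 by apply: sqrtCK.
apply: (hPR (m := n.*2%:Z)); try lia.
by left; split => //; apply: sE; rewrite ?sqrrN.
Qed.

(** Here the eigenvalues are q and the roots of z^2 - (1 - 2q) z + q^2, with discriminant 1 - 4q;
    both roots equal q at q = 1/4. *)
Lemma rho_T_alpha121_exp n : (0 < n)%N ->
  (rho_T q *m (rho_alpha1 C *m rho_alpha2 C *m rho_alpha1 C)) ^+ n.*2 <>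
  (q ^+ n.*2)%:M.
Proof.
move=> n0 Mn; have [q4|qn4] := eqVneq q 4^-1.
  suff /eqP : n.*2%:R = 0 :> C by rewrite pnatr_eq0 double_eq0 eqn0Ngt n0.
  apply: (jordan_exp (v := row3 2 (-1) 2) (w := row3 2 (- 2^-1) 0) _ q_neq0 _ _ Mn).
  - by rewrite row3_eq0 pnatr_eq0.
  - by rewrite /rho_T !mx3_mul row3_mul row3Z q4; congr row3; field.
  - by rewrite /rho_T !mx3_mul row3_mul row3D row3Z q4; congr row3; field.
pose s := sqrtC (1 - 4 * q).
have root_exp z : z ^+ 2 = (1 - 2 * q) * z - q ^+ 2 -> z ^+ n.*2 = q ^+ n.*2.
  move=> z2; apply: (eigen_exp (v := row3 z (z ^+ 2 - (1 - q) * z) q)) Mn.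
    by rewrite row3_eq0 (negbTE q_neq0) !andbF.
  rewrite /rho_T !mx3_mul row3_mul row3Z; congr row3; by ring: z2.
have sE e : e ^+ 2 = 1 - 4 * q ->
    (2 * q) ^ (- (2 * n.*2%:Z)) * (1 - 2 * q + e) ^ (2 * n.*2%:Z) = 1.
  move=> e2; have -> : 1 - 2 * q + e = 2 * ((1 - 2 * q + e) / 2) by field.
  by apply/half_exp_eq1/root_exp; field: e2.
have s2 : s ^+ 2 = 1 - 4 * q by apply: sqrtCK.
apply: (hPR (m := n.*2%:Z)); try lia.
by right; split => //; apply: sE; rewrite ?sqrrN.
Qed.

Lemma rho_T_alpha_exp n b : (0 < n)%N -> b \in rho_alphas C ->
  (rho_T q *m b) ^+ n.*2 <> (q ^+ n.*2)%:M.
Proof.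
move=> n0; have qn1 : q ^+ n.*2 != 1 by apply: not_root_unity; lia.
rewrite !inE => /or4P[/eqP->|/eqP->|/eqP->|/orP[]/eqP->] Mn.
- have := eigen_exp (z := 1) (v := row3 0 1 0) _ _ Mn.
  rewrite expr1n => e; move/eqP: qn1; apply; rewrite -e //.
    by rewrite row3_eq0 oner_eq0 andbF.
  by rewrite /rho_T !mx3_mul row3_mul row3Z; congr row3; ring.
- exact: rho_T_alpha2_exp Mn.
(* The involutions cancel and leave [rho_sigma2 q], whose last row shows the eigenvalue q^2; hence
   q^(4n) = q^(2n). *)
- have := eigen_exp (z := q ^+ 2) (v := row3 0 0 1) _ _ Mn.
  rewrite exprAC => e; move/eqP: qn1; apply.
  apply: (mulfI (expf_neq0 n.*2 q_neq0)); rewrite mulr1 -expr2 e //.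
    by rewrite row3_eq0 oner_eq0 !andbF.
  by rewrite /rho_T !mx3_mul row3_mul row3Z; congr row3; ring.
- have := eigen_exp (z := 1) (v := row3 0 1 0) _ _ Mn.
  rewrite expr1n => e; move/eqP: qn1; apply; rewrite -e //.
    by rewrite row3_eq0 oner_eq0 andbF.
  by rewrite /rho_T !mx3_mul row3_mul row3Z; congr row3; ring.
- exact: rho_T_alpha121_exp Mn.
Qed.

End Scalars.

(** * Transfer along rho and the three cases *)

Section Main.
Local Open Scope group_scope.
Variables (K : fieldType) (q : K) (rho : {multiplicative C3 -> GL K 3}).
Hypothesis rhoP : is_rho q rho.

Lemma GLvalX (g : GL K 3) n : Defs.GLval (g ^+ n) = (Defs.GLval g ^+ n)%R.
Proof. by elim: n => // n IH; rewrite expgS exprS -IH. Qed.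

Lemma rho_T_val : Defs.GLval (rho T) = rho_T q.
Proof. by case: rhoP => _ s2 a1 a2; rewrite !gmulfM /= s2 a1 a2. Qed.

Lemma rho_TT_commute g : commute g (rho T * rho T).
Proof.
apply: val_inj => /=.
by rewrite rho_T_val rho_TT scalar_mxC.
Qed.

Lemma rho_eval_alpha w : w \in alpha_words ->
  Defs.GLval (rho (eval w)) \in rho_alphas K.
Proof.
case: rhoP => _ _ a1 a2.
rewrite !inE => /or4P[/eqP->|/eqP->|/eqP->|/orP[]/eqP->];
  rewrite /eval !big_cons big_nil /= ?mulg1 ?mulgA ?gmulfM /= ?a1 ?a2 eqxx;
  by rewrite ?orbT.
Qed.

Lemma rho1 : rho 1 = 1.
Proof. by apply: (mulgI (rho 1)); rewrite -gmulfM !mulg1. Qed.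

Lemma rhoV g : rho g^-1 = (rho g)^-1.
Proof. by apply: (mulgI (rho g)); rewrite -gmulfM !mulgV rho1. Qed.

Lemma rhoX g n : rho (g ^+ n) = rho g ^+ n.
Proof. by elim: n => [|n IH]; rewrite ?rho1 // !expgS gmulfM IH. Qed.

Lemma rho_tword (a : nat -> C3) r :
  rho (\prod_(1 <= i < r) (a i * T) * a r) =
  tword (rho T) (fun i => rho (a i)) 1 r.
Proof.
rewrite gmulfM /tword; congr (_ * _).
rewrite (big_morph (rho : C3 -> GL K 3) (@gmulfM _ _ rho) rho1).
by apply: eq_bigr => i _; rewrite gmulfM.
Qed.

End Main.

Theorem theorem11
  (R : realType) (q : R[i])
  (q_neq0 : q != 0%R)
  (hq6 : forall k : int, k != 0%R -> (q ^ (6 * k) != 1)%R)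
  (hPR : forall m : int, m != 0%R -> (2 %| m)%Z -> ~ (P_ m q \/ R_ m q))
  (hS : forall n : int, n != 0%R -> ~ S_ n q)
  (rho : {multiplicative C3 -> GL R[i] 3}) (rhoP : is_rho q rho)
  (r : nat) (r_ge3 : (3 <= r)%N) (r_odd : odd r)
  (A : nat -> word)
  (hA : forall i : nat, (1 <= i <= r)%N -> A i \in alpha_words)
  (heven : ~~ odd (\sum_(1 <= i < r.+1) wlength (A i))%N)
  (x : C3)
  (hx : (x = (\prod_(1 <= i < r) (eval (A i) * T)) * eval (A r) * T ^- r.-1 \/
         x = T ^- r.-1 * ((\prod_(1 <= i < r) (eval (A i) * T)) * eval (A r)))%g)
  (habc :
     (* (a) *)
     (forall j : nat, (2 <= j <= r - 1)%N ->
        eval (A j) = (eval (A r) * eval (A 1%N))%g) \/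
     (* (b) *)
     (forall j : nat, (1 <= j <= (r - 1) %/ 2)%N ->
        (eval (A (r + 1 - j)%N) * eval (A j) = 1)%g) \/
     (* (c) *)
     (exists i : nat,
        (2 * i + 5 <= r)%N /\
        (forall j : nat, (1 <= j <= i + 1)%N ->
           (eval (A (r + 1 - j)%N) * eval (A j) = 1)%g) /\
        (forall j : nat, (i + 3 <= j <= r - i - 2)%N ->
           eval (A j) = (eval (A (r - i - 1)%N) * eval (A (i + 2)%N))%g))) :
  rho x <> 1%g.
Proof.
move=> rhox1; pose a i := rho (eval (A i)).
have [n rE] : exists n, r = (1 + n.+1.*2)%N by exists (r./2.-1); lia.
have ttC := rho_TT_commute rhoP.
have tw : tword (rho T) a 1 (1 + n.+1.*2) = (rho T ^+ n.+1.*2)%g.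
  rewrite /a -rE -rho_tword; have -> : n.+1.*2 = r.-1 by rewrite rE.
  (* Both forms of x give the same relation, because r - 1 is even and rho(T)^(r-1) is central. *)
  move: hx; set w := (\prod_(1 <= i < r) _ * eval _)%g => hx'; clearbody w.
  apply: (mulIg (rho T ^- r.-1)%g).
  rewrite mulgV -rhox1; case: hx' => ->; rewrite [RHS]gmulfM rhoV rhoX //.
  by rewrite rE; apply: commuteV; apply: even_expg_commute.
have inA i : (1 <= i <= r)%N -> Defs.GLval (a i) \in rho_alphas _.
  by move=> hi; apply/(rho_eval_alpha rhoP)/hA.
have peel k l : (n.+1 = l + k)%N ->
    (forall j, (1 <= j <= k)%N ->
       eval (A (r + 1 - j)%N) * eval (A j) = 1)%g ->
    tword (rho T) a (1 + k) (1 + k + l.*2) = (rho T ^+ l.*2)%g.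
  move=> nE hV; apply: tword_peel; rewrite -?nE // => j jk.
  have aV : (a (r - j) * a j.+1 = 1)%g.
    rewrite /a -gmulfM; have := hV j.+1 jk.
    have -> : (r + 1 - j.+1 = r - j)%N by lia.
    by move=> e; rewrite [X in rho X]e rho1.
  by rewrite -rE.
(* Common form of (a), with k = 0, and (c), with k = i + 1: after k inverse pairs are peeled, 2l + 1
   equal letters remain between the ends. *)
have const k l : (n.+1 = l.+1 + k)%N ->
    (forall j, (1 <= j <= k)%N ->
       eval (A (r + 1 - j)%N) * eval (A j) = 1)%g ->
    (forall j : nat, (k + 2 <= j <= r - k - 1)%N ->
       eval (A j) = eval (A (r - k)%N) * eval (A (k + 1)%N))%g -> False.
  move=> nE /(peel k _ nE) tk hE.
  (* The common value is represented by the letter k + 2 rather than by the product of the end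
     letters, so that it visibly lies in [rho_alphas]. *)
  have hj j : (1 + k < j < 1 + k + l.+1.*2)%N -> a j = a (k + 2)%N.
    by move=> jk; rewrite /a (hE j) ?(hE (k + 2)%N) //; lia.
  have aV : (a (1 + k + l.+1.*2)%N * a (1 + k)%N = a (k + 2)%N)%g.
    have -> : (1 + k + l.+1.*2 = r - k)%N by lia.
    rewrite /a -gmulfM (addnC 1); congr (rho _).
    by rewrite (hE (k + 2)%N) //; lia.
  have /(congr1 (@Defs.GLval _ _)) := tword_const (n := l.+1) ttC isT hj aV tk.
  rewrite !GLvalX /= (rho_T_val rhoP) rho_T_exp -exprM muln2.
  by apply: rho_T_alpha_exp => //; apply: inA; lia.
case: habc => [hc|[hb|[i [ir [hb hc]]]]].
- apply: (const 0%N n); rewrite ?addn0 //; last by rewrite subn0.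
  by move=> j; lia.
(* Peeling all n + 1 pairs leaves the middle letter, of index n + 2 = (r + 1)/2, equal to
   rho(T)^0. *)
- have := peel n.+1 0%N erefl _; rewrite addn0 /tword big_geq // mul1g.
  rewrite expg0 => /(_ _)/(congr1 (@Defs.GLval _ _)) /= a1.
  have /rho_alphas_neq1/eqP[] := inA (1 + n.+1)%N ltac:(lia).
  by apply: a1 => j hj; apply: hb; lia.
- apply: (const (i + 1)%N (n - i.+1)%N); first lia.
    exact: hb.
  move=> j hj; rewrite hc; last by lia.
  by congr (eval (A _) * eval (A _))%g; lia.
Qed.
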